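(* Let $\tau$ be an operational type. Priestley topological algebras of type $\tau$ are, up to isomorphism, precisely the extended Priestley duals of those residuation algebras of type $\tau$ that embed as residuation ideals in Boolean residuation algebras of type $\tau$ for which residuation is join preserving at primes. Here a Priestley topological algebra $X$ is regarded as the Priestley space $X$ with the relations $R_f=\{(x_1,\ldots,x_n,z)\mid z\leq f(x_1,\ldots,x_n)\}$, for each $n$-ary $f\in\tau$.
   Context: All operation symbols of $\tau$ have finite arity $n\geq 1$. A Priestley space is a compact ordered topological space that is totally order disconnected: whenever $x\nleq y$ there is a clopen down-set $U$ with $y\in U$ and $x\notin U$. A Priestley topological algebra of type $\tau$ is a Priestley space with an algebra structure of type $\tau$ whose basic operations are continuous and order preserving. A residuation algebra of type $\tau$ is a bounded distributive lattice $D$ with, for each $n$-ary $f\in\tau$ and each $1\leq i\leq n$, an operation $f_i^{\sharp}:D^n\to D$, written $f_i^{\sharp}(a_1,\ldots,a_{i-1},a_{i+1},\ldots,a_n,c)$, such that each $f_i^\sharp$ preserves finite meets (including the empty one) in its last coordinate and, for all $i,j$ and all $a_1,\ldots,a_n,c\in D$, $a_i\leq f_i^{\sharp}(a_1,\ldots,a_{i-1},a_{i+1},\ldots,a_n,c)\iff a_j\leq f_j^{\sharp}(a_1,\ldots,a_{j-1},a_{j+1},\ldots,a_n,c)$. It is Boolean if the lattice is Boolean. For filters $F_1,\ldots,F_n$ of $D$ let $f(F_1,\ldots,F_n)=\{c\in D\mid \exists a_j\in F_j\ (1\le j\le n-1)\text{ with } f_n^\sharp(a_1,\ldots,a_{n-1},c)\in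 F_n\}$, which is a filter. Residuation is join preserving at primes if for every $f\in\tau$ this operation sends tuples of prime (in particular proper) filters to prime filters. A residuation ideal of a residuation algebra $B$ is a bounded sublattice $C$ of $B$ such that for all $c\in C$ and $b_j\in B$ and all $f,i$, $f_i^\sharp(b_1,\ldots,b_{i-1},b_{i+1},\ldots,b_n,c)\in C$. A residuation algebra $D$ embeds as a residuation ideal in $B$ if there is an injective bounded lattice homomorphism $D\to B$ preserving all operations $f_i^\sharp$ whose image is a residuation ideal of $B$. The extended Priestley dual of a residuation algebra $D$ is the Priestley space $X_D$ (points $x$ are prime filters $F_x$; $x\leq y\iff F_x\supseteq F_y$; topology generated by the sets $\{x\mid a\in F_x\}$ and their complements, $a\in D$) with, for each $n$-ary $f$, the relation $R_f$ given by: $(x_1,\ldots,x_n,z)\in R_f$ iff for all $a_j\in F_{x_j}$ ($j\neq i$) and all $c\notin F_z$, $f_i^\sharp(a_1,\ldots,a_{i-1},a_{i+1},\ldots,a_n,c)\notin F_{x_i}$ (independent of $i$). Isomorphisms are order isomorphisms that are homeomorphisms and preserve and reflect the relations. *)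

(* Defs.v *)
From HB Require Import structures.
From mathcomp Require Import all_boot all_order.
From mathcomp Require Import all_classical all_reals all_analysis.

Set Implicit Arguments.
Unset Strict Implicit.
Unset Printing Implicit Defensive.

Import Order.TTheory.

Local Open Scope classical_set_scope.
Local Open Scope order_scope.

Record optype := OpType {
  opsym : Type;
  arity : opsym -> nat;
  arity_gt0 : forall f, (0 < arity f)%N
}.

Fact last_arg_subproof (tau : optype) (f : opsym tau) :
  ((arity f).-1 < arity f)%N.
Proof. by rewrite ltn_predL arity_gt0. Qed.

Definition last_arg (tau : optype) (f : opsym tau) : 'I_(arity f) :=
  Ordinal (last_arg_subproof f).

(* An n-tuple with its i-th entry left out is a function on 'I_n.-1, its entry
   at k standing in position lift i k of the full tuple. Thus res f i a c is
   f_i^#(a_1, .., a_(i-1), a_(i+1), .., a_n, c). *)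
HB.mixin Record isResiduation (tau : optype) (d : Order.disp_t) D
    of Order.TBDistrLattice d D := {
  res : forall f : opsym tau,
    'I_(arity f) -> ('I_(arity f).-1 -> D) -> D -> D;
  res_top : forall (f : opsym tau) (i : 'I_(arity f)) (a : 'I_(arity f).-1 -> D),
    res f i a \top = \top;
  res_meet : forall (f : opsym tau) (i : 'I_(arity f)) (a : 'I_(arity f).-1 -> D)
      (b c : D),
    res f i a (b `&` c) = res f i a b `&` res f i a c;
  res_exchange : forall (f : opsym tau) (i j : 'I_(arity f))
      (a : 'I_(arity f) -> D) (c : D),
    a i <= res f i (fun k => a (lift i k)) c <->
    a j <= res f j (fun k => a (lift j k)) c
}.

#[short(type="residuationAlgType")]
HB.structure Definition ResiduationAlg (tau : optype) (d : Order.disp_t) :=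
  { D of Order.TBDistrLattice d D & isResiduation tau d D }.

#[short(type="boolResiduationAlgType")]
HB.structure Definition BoolResiduationAlg (tau : optype) (d : Order.disp_t) :=
  { D of Order.CTBDistrLattice d D & isResiduation tau d D }.

Definition is_filter d (D : tbDistrLatticeType d) (F : set D) : Prop :=
  [/\ F \top,
      forall a b, F a -> F b -> F (a `&` b) &
      forall a b, a <= b -> F a -> F b].

Definition is_prime_filter d (D : tbDistrLatticeType d) (F : set D) : Prop :=
  [/\ is_filter F, ~ F \bot & forall a b, F (a `|` b) -> F a \/ F b].

Definition filter_op tau d (D : residuationAlgType tau d) (f : opsym tau)
    (F : 'I_(arity f) -> set D) : set D :=
  [set c | exists a : 'I_(arity f).-1 -> D,
     (forall k, F (lift (last_arg f) k) (a k)) /\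
     F (last_arg f) (res f (last_arg f) a c)].

Definition join_preserving_at_primes tau d (D : residuationAlgType tau d) :
    Prop :=
  forall (f : opsym tau) (F : 'I_(arity f) -> set D),
    (forall j, is_prime_filter (F j)) -> is_prime_filter (filter_op F).

Definition residuation_ideal tau d (B : residuationAlgType tau d)
    (C : set B) : Prop :=
  [/\ C \bot, C \top,
      forall a b, C a -> C b -> C (a `&` b),
      forall a b, C a -> C b -> C (a `|` b) &
      forall (f : opsym tau) (i : 'I_(arity f)) (b : 'I_(arity f).-1 -> B)
        (c : B), C c -> C (res f i b c)].

(* The library's {tblmorphism D -> B} only asks for the preservation of \bot
   and \top, so all the homomorphism conditions are spelled out. *)
Definition embeds_as_residuation_ideal tau d (D : residuationAlgType tau d)
    d' (B : residuationAlgType tau d') : Prop :=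
  exists h : D -> B,
    [/\ injective h,
        h \bot = \bot /\ h \top = \top,
        Order.meet_morphism h /\ Order.join_morphism h,
        forall (f : opsym tau) (i : 'I_(arity f)) (a : 'I_(arity f).-1 -> D)
          (c : D), h (res f i a c) = res f i (h \o a) (h c) &
        residuation_ideal (range h)].

HB.mixin Record isPriestley (d : Order.disp_t) X of POrderedTopological d X := {
  priestley_compact : compact [set: X];
  priestley_separated : forall x y : X, ~ (x <= y) ->
    exists U : set X,
      [/\ clopen U, forall u v, u <= v -> U v -> U u, U y & ~ U x]
}.

#[short(type="priestleyType")]
HB.structure Definition Priestley (d : Order.disp_t) :=
  { X of POrderedTopological d X & isPriestley d X }.

HB.mixin Record isPriestleyAlg (tau : optype) (d : Order.disp_t) X
    of Priestley d X := {
  op : forall f : opsym tau, ('I_(arity f) -> X) -> X;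
  op_continuous : forall f : opsym tau,
    continuous (op f : prod_topology (fun _ : 'I_(arity f) => X) -> X);
  op_monotone : forall (f : opsym tau) (x y : 'I_(arity f) -> X),
    (forall j, x j <= y j) -> op f x <= op f y
}.

#[short(type="priestleyAlgType")]
HB.structure Definition PriestleyAlg (tau : optype) (d : Order.disp_t) :=
  { X of Priestley d X & isPriestleyAlg tau d X }.

Record ext_space (tau : optype) := ExtSpace {
  ext_disp : Order.disp_t;
  ext_carrier :> POrderedTopological.type ext_disp;
  ext_rel : forall f : opsym tau,
    ('I_(arity f) -> ext_carrier) -> ext_carrier -> Prop
}.

Definition ext_iso tau (X Y : ext_space tau) : Prop :=
  exists (phi : X -> Y) (psi : Y -> X),
    [/\ cancel phi psi /\ cancel psi phi,
        continuous phi /\ continuous psi,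
        {mono phi : x y / x <= y} &
        forall (f : opsym tau) (x : 'I_(arity f) -> X) (z : X),
          ext_rel x z <-> ext_rel (phi \o x) (phi z)].

Definition priestleyAlg_space tau d (X : priestleyAlgType tau d) :
    ext_space tau :=
  @ExtSpace tau d X (fun f x z => z <= op f x).

Record prime_filter d (D : tbDistrLatticeType d) := PrimeFilter {
  pf_set : set D;
  pf_prime : is_prime_filter pf_set
}.

Fact dual_display (d : Order.disp_t) : Order.disp_t. Proof. exact: d. Qed.

Section DualSpace.
Context d (D : tbDistrLatticeType d).
Local Notation X := (prime_filter D).

HB.instance Definition _ := gen_eqMixin X.
HB.instance Definition _ := gen_choiceMixin X.

Definition pf_le (x y : X) : bool := `[< pf_set y `<=` pf_set x >].

Fact pf_le_refl : reflexive pf_le.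
Proof. by move=> x; apply/asboolP. Qed.

Fact pf_le_anti : antisymmetric pf_le.
Proof.
move=> [F pF] [G pG] /andP[/asboolP /= GF /asboolP /= FG].
have E : F = G by apply/seteqP.
by subst G; congr PrimeFilter; apply: Prop_irrelevance.
Qed.

Fact pf_le_trans : transitive pf_le.
Proof.
by move=> y x z /asboolP yx /asboolP zy; apply/asboolP => a /zy /yx.
Qed.

HB.instance Definition _ := Order.Le_isPOrder.Build (dual_display d) X
  pf_le_refl pf_le_anti pf_le_trans.

Definition pf_subbase : set (set X) :=
  [set U | exists a : D,
     U = [set x : X | pf_set x a] \/ U = ~` [set x : X | pf_set x a]].

HB.instance Definition _ := isSubBaseTopological.Build X pf_subbase id.

End DualSpace.

Definition dual_rel_at tau d (D : residuationAlgType tau d) (f : opsym tau)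
    (i : 'I_(arity f)) (x : 'I_(arity f) -> prime_filter D)
    (z : prime_filter D) : Prop :=
  forall (a : 'I_(arity f).-1 -> D) (c : D),
    (forall k, pf_set (x (lift i k)) (a k)) -> ~ pf_set z c ->
    ~ pf_set (x i) (res f i a c).

Lemma dual_rel_at_indep tau d (D : residuationAlgType tau d) (f : opsym tau)
    (i j : 'I_(arity f)) (x : 'I_(arity f) -> prime_filter D)
    (z : prime_filter D) :
  dual_rel_at i x z <-> dual_rel_at j x z.
Proof.
suff imp i' j' : dual_rel_at i' x z -> dual_rel_at j' x z by split; apply: imp.
move=> R a c xa zc xc.
pose b k := if unlift j' k is Some k' then a k' else res f j' a c.
have bE : (fun k => b (lift j' k)) = a by apply/funext=> k; rewrite /b liftK.
have xb k : pf_set (x k) (b k).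
  by rewrite /b; case: unliftP => [k'|] ->; [exact: xa|].
have /(res_exchange f i' j' b c) le_b :
    b j' <= res f j' (fun k => b (lift j' k)) c.
  by rewrite bE /b unlift_none.
have [[_ _ up] _ _] := pf_prime (x i').
exact: (R (fun k => b (lift i' k)) c _ zc (up _ _ le_b (xb i'))).
Qed.

Definition dual_rel tau d (D : residuationAlgType tau d) (f : opsym tau)
    (x : 'I_(arity f) -> prime_filter D) (z : prime_filter D) : Prop :=
  dual_rel_at (last_arg f) x z.

Definition dual_space tau d (D : residuationAlgType tau d) : ext_space tau :=
  @ExtSpace tau (dual_display d) (prime_filter D) (@dual_rel tau d D).

(* Main.v *)
Require Import Defs.
From HB Require Import structures.
From mathcomp Require Import all_boot all_order finmap.
From mathcomp Require Import all_classical all_reals all_analysis.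

(** Both halves rest on one symmetric description of the operation on filters
    ([filter_opP]): c lies in f(F_1, .., F_n) iff some a_1, .., a_n, one in each
    F_j, satisfy a_n <= f_n^#(a_1, .., a_(n-1), c), an inequality that the
    exchange law lets one read at any coordinate. For a residuation algebra of
    subsets of X it says that f maps the box a_1 x .. x a_n into c
    ([member_resP]). In the dual space, (x_1, .., x_n, z) is in R_f iff
    f(F_(x_1), .., F_(x_n)) is included in F_z ([dual_relE]).

    From spaces to algebras. Let B be the clopen subsets of X and D the clopen
    down-sets, with f_i^#(a, c) the set of those t such that f sends every tuple
    with i-th entry t and other entries in the a_k into c. Compactness makes
    this set clopen ([residual_clopen]), and it is a down-set as soon as c is
    one, whatever the a_k are; this is why D is a residuation ideal of B. By
    compactness prime filters of B or of D are points of X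
    ([prime_filter_point]), and if c is a clopen set containing every f(y) such
    that y_j is in all the members of the family containing x_j, then f already
    maps a box of members around x into c ([op_box]). For B such a y is x, so
    f(F_(x_1), .., F_(x_n)) = F_(f(x)) is prime. For D such a y is below x, and
    the inclusion of f(F_(x_1), .., F_(x_n)) in F_z becomes z <= f(x).

    From algebras to spaces. Let D be a residuation ideal of B, with inclusion
    h, and let G_j be filters of B. In a witness a_1, .., a_n in B of
    h(c) in f(G_1, .., G_n), each a_i can be enlarged to f_i^#(.., h(c)), which
    lies in D by the ideal property; hence f commutes with restriction of
    filters to D ([filter_op_preimage]). As prime filters of D extend to prime
    filters of B ([prime_filter_lift]), f preserves prime filters of D, and
    defines an operation on the dual space of D whose relation is R_f. The set
    of x with c in f(x) is open, being a union of boxes. It is also closed: its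
    preimage in the power of the dual space of B is closed, because its
    complement is the set of y with ~ h(c) in f(y), and restriction is a
    continuous map from a compact space onto a Hausdorff one
    ([filter_op_closed]). *)

Set Implicit Arguments.
Unset Strict Implicit.
Unset Printing Implicit Defensive.

Import Order.Theory.

Local Open Scope order_scope.
Local Open Scope classical_set_scope.

(** * Prime filters of distributive lattices *)

(** A filter maximal among those that contain F and avoid I is prime: were a and
    b outside it with their join inside, the filters obtained by adding a, resp.
    b, would meet I, and distributivity would put an element of the filter
    in I. *)
Lemma prime_filter_separation d (D : tbDistrLatticeType d) (F I : set D) :
    is_filter F -> (forall a b, a <= b -> I b -> I a) ->
    (forall a b, I a -> I b -> I (a `|` b)%O) -> (forall a, F a -> ~ I a) ->
    I \bot ->
  exists G, [/\ is_prime_filter G, F `<=` G & forall a, G a -> ~ I a].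
Proof.
move=> fF Idown Ijoin FI Ibot.
(* The empty set is admitted so that the empty chain has its union in P. *)
pose P (A : set D) :=
  A = set0 \/ [/\ is_filter A, F `<=` A & forall a, A a -> ~ I a].
have [C CP Ctot|A [PA maxA]] := @Zorn_bigcup D P.
  have [[A0 CA0 A0n]|C0] := pselect (exists2 A, C A & A !=set0); last first.
    left; apply/seteqP; split=> // a [A CA Aa].
    by case: C0; exists A => //; exists a.
  have good A : C A -> forall a, A a ->
      [/\ is_filter A, F `<=` A & forall a, A a -> ~ I a].
    by move=> CA a Aa; case: (CP A CA) => [A00|//]; rewrite A00 in Aa.
  case: A0n => a0 A0a0; have [[A0t A0I A0up] FA0 A0I0] := good _ CA0 _ A0a0.
  right; split; [split| |].
  - by exists A0.
  - move=> a b [A CA Aa] [B CB Bb].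
    have [AB|BA] := Ctot _ _ CA CB.
      exists B => //; have [[_ BI _] _ _] := good _ CB _ Bb.
      by apply: BI => //; exact: AB.
    exists A => //; have [[_ AI _] _ _] := good _ CA _ Aa.
    by apply: AI => //; exact: BA.
  - move=> a b ab [A CA Aa]; exists A => //.
    by have [[_ _ Aup] _ _] := good _ CA _ Aa; exact: Aup ab Aa.
  - by move=> a Fa; exists A0 => //; exact: FA0.
  - by move=> a [A CA Aa]; have [_ _] := good _ CA _ Aa; exact.
have [Ft _ _] := fF.
case: PA => [A0|[[At AI Aup] FA AI0]].
  have A0F : A `<` F.
    by rewrite A0; split=> [//|/(_ _ Ft)].
  by case: (maxA _ A0F); right; split.
exists A; split=> //; split=> [//|/AI0|a b Aab]; first exact.
apply: contrapT => /not_orP[nAa nAb].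
have meetI c : ~ A c -> exists2 g, A g & I (g `&` c)%O.
  move=> nAc; apply: contrapT => nI.
  have AAc : A `<` [set x | exists2 g, A g & (g `&` c)%O <= x].
    split=> [x Ax|/(_ c)]; first by exists x => //; exact: leIl.
    by move=> H; apply/nAc/H; exists \top => //; exact: leIr.
  case: (maxA _ AAc); right; split; [split| |].
  - by exists \top => //; exact: lex1.
  - move=> x y [g Ag gx] [k Ak ky]; exists (g `&` k)%O; first exact: AI.
    rewrite lexI; apply/andP; split.
      by apply: le_trans gx; rewrite leI2 // leIl.
    by apply: le_trans ky; rewrite leI2 // leIr.
  - by move=> x y xy [g Ag gx]; exists g => //; exact: le_trans xy.
  - by move=> x Fx; exists x; [exact: FA|exact: leIl].
  - by move=> x [g Ag gx] Ix; apply: nI; exists g => //; exact: Idown gx Ix.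
have [g Ag Iga] := meetI _ nAa; have [k Ak Ikb] := meetI _ nAb.
apply: (AI0 ((g `&` k) `&` (a `|` b))%O); first by do 2!apply: (AI) => //.
rewrite meetUr; apply: Ijoin.
  by apply: Idown Iga; rewrite leI2 // leIl.
by apply: Idown Ikb; rewrite leI2 // leIr.
Qed.

Section LatticeEmbedding.
Context d (D : tbDistrLatticeType d) d' (B : tbDistrLatticeType d').
Variable h : D -> B.
Hypotheses (h_bot : h \bot = \bot) (h_top : h \top = \top).
Hypotheses (h_meet : Order.meet_morphism h) (h_join : Order.join_morphism h).

Lemma prime_filter_preimage (G : set B) :
  is_prime_filter G -> is_prime_filter (h @^-1` G).
Proof.
move=> [[Gt GI Gup] Gb GU]; split; [split| |].
- by rewrite /= h_top.
- by move=> a b Ga Gb'; rewrite /= h_meet; exact: GI.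
- move=> a b /meet_idPl ab Ga; apply: Gup Ga.
  by rewrite -ab h_meet; exact: leIr.
- by rewrite /= h_bot.
- by move=> a b; rewrite /= h_join; exact: GU.
Qed.

(** The filter generated by h(F) avoids the ideal generated by the image of the
    complement of F because an injective h reflects the order; any prime filter
    separating the two restricts to F. *)
Lemma prime_filter_lift (F : set D) : injective h -> is_prime_filter F ->
  exists2 G, is_prime_filter G & h @^-1` G = F.
Proof.
move=> h_inj [[Ft FI Fup] Fb FU].
have h_le a b : h a <= h b -> a <= b.
  by move=> /meet_idPl ab; apply/meet_idPl/h_inj; rewrite h_meet.
have [|||b [a Fa ab] [c nFc bc]||G [pG FG GI]] :=
  @prime_filter_separation _ B [set b | exists2 a, F a & h a <= b]
    [set b | exists2 a, ~ F a & b <= h a].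
- split.
  + by exists \top => //; exact: lex1.
  + move=> x y [a Fa ax] [b Fb' bx]; exists (a `&` b)%O; first exact: FI.
    by rewrite h_meet leI2.
  + by move=> x y xy [a Fa ax]; exists a => //; exact: le_trans xy.
- by move=> x y xy [a Fa ya]; exists a => //; exact: le_trans ya.
- move=> x y [a Fa xa] [b Fb' yb]; exists (a `|` b)%O; first by move=> /FU[].
  by rewrite h_join leU2.
- by apply: nFc; apply: Fup Fa; apply: h_le; exact: le_trans bc.
- by exists \bot => //; exact: le0x.
exists G => //; apply/seteqP; split=> a /=.
  by move=> Ga; apply: contrapT => nFa; apply: (GI (h a)) => //; exists a.
by move=> Fa; apply: FG; exists a.
Qed.

End LatticeEmbedding.

(** * The operation on filters and residuation ideals *)

Section FilterOp.
Context tau d (D : residuationAlgType tau d).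

Definition residual_witness (f : opsym tau) (a : 'I_(arity f) -> D) (c : D) :=
  a (last_arg f) <= res f (last_arg f) (a \o lift (last_arg f)) c.

(** Treating all coordinates alike, this form of membership can be transported
    from one coordinate to another by the exchange law. *)
Lemma filter_opP (f : opsym tau) (F : 'I_(arity f) -> set D) (c : D) :
  (forall j, is_filter (F j)) ->
  filter_op F c <->
  exists2 a : 'I_(arity f) -> D,
    (forall j, F j (a j)) & residual_witness a c.
Proof.
move=> fF; split=> [[a [Fa Fc]]|[a Fa ac]].
  pose b k := if unlift (last_arg f) k is Some k' then a k'
              else res f (last_arg f) a c.
  have bE : b \o lift (last_arg f) = a by apply/funext=> k; rewrite /b /= liftK.
  exists b.
    by move=> j; rewrite /b; case: unliftP => [k ->|->].
  by rewrite /residual_witness bE /b unlift_none.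
exists (a \o lift (last_arg f)); split=> [k|]; first exact: Fa.
by have [_ _ up] := fF (last_arg f); exact: up ac (Fa _).
Qed.

End FilterOp.

(** One coordinate at a time, an entry b_i of a witness in B is replaced by
    f_i^#(.., h c), the largest value allowed there: it stays in the filter G_i
    and belongs to the range of h because h c does. *)
Lemma filter_op_preimage tau d (D : residuationAlgType tau d)
    d' (B : residuationAlgType tau d') (h : D -> B)
    (f : opsym tau) (G : 'I_(arity f) -> set B) :
  (forall (f : opsym tau) (i : 'I_(arity f)) a c,
     h (res f i a c) = res f i (h \o a) (h c)) ->
  residuation_ideal (range h) ->
  (forall j, is_filter (G j)) ->
  h @^-1` filter_op G = filter_op (fun j => h @^-1` G j).
Proof.
move=> h_res [_ _ _ _ h_ideal] fG; apply/seteqP; split=> c /=; last first.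
  by move=> [a [Ga Gc]]; exists (h \o a); split=> //; rewrite -h_res.
move=> /filter_opP -/(_ fG) [a0 Ga0 a0c].
have /(_ (arity f)) [b Gb [rb bc]] : forall k : nat,
    exists2 b : 'I_(arity f) -> B, (forall j, G j (b j)) &
      (forall j : 'I_(arity f), (j < k)%N -> range h (b j)) /\
      residual_witness b (h c).
  elim=> [|k [b Gb [rb bc]]]; first by exists a0.
  have [kn|nk] := ltnP k (arity f); last first.
    by exists b => //; split=> // j _; apply: rb; exact: leq_trans nk.
  pose i := Ordinal kn.
  pose e := res f i (b \o lift i) (h c).
  pose b' j := if j == i then e else b j.
  have b'i : b' i = e by rewrite /b' eqxx.
  have b'l : b' \o lift i = b \o lift i.
    by apply/funext => j; rewrite /b' /= eq_sym (negbTE (neq_lift _ _)).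
  exists b'.
    move=> j; rewrite /b'; case: eqP => [->|//].
    have [_ _ up] := fG i; apply: up (Gb i).
    exact/(res_exchange f (last_arg f) i b (h c)).
  split=> [j|].
    rewrite /b' ltnS leq_eqVlt; case: (j =P i) => [_ _|ji /orP[/eqP jk|]].
    - by apply: h_ideal; exists c.
    - by case: ji; exact: val_inj.
    - exact: rb.
  apply/(res_exchange f i (last_arg f) b' (h c)).
  by rewrite -[X in res f i X _]/(b' \o lift i) b'l b'i.
have {}rb j : range h (b j) by exact: rb.
have /choice [a ha] : forall j, exists x, h x = b j.
  by move=> j; have [x _ <-] := rb j; exists x.
exists (a \o lift (last_arg f)); split=> [k|]; first by rewrite /= ha.
have [_ _ up] := fG (last_arg f); apply: up (Gb _).
rewrite h_res; apply: le_trans bc _.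
by rewrite (_ : h \o _ = b \o lift (last_arg f)) //; apply/funext => k /=.
Qed.

Lemma residuation_ideal_join_preserving tau d (D : residuationAlgType tau d)
    d' (B : residuationAlgType tau d') :
  embeds_as_residuation_ideal D B -> join_preserving_at_primes B ->
  join_preserving_at_primes D.
Proof.
move=> [h [h_inj [h_bot h_top] [h_meet h_join] h_res h_ideal]] jpB f F pF.
have /choice [G pG] : forall j,
    exists G, is_prime_filter G /\ h @^-1` G = F j.
  move=> j; have [G] := prime_filter_lift h_meet h_join h_inj (pF j).
  by exists G.
have -> : F = fun j => h @^-1` G j by apply/funext => j; have [_ ->] := pG j.
rewrite -filter_op_preimage //; last by move=> j; have [[]] := pG j.
apply: prime_filter_preimage => //.
by apply: jpB => j; have [] := pG j.
Qed.

(** * Topological preliminaries *)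

(** The power is written with the product topology in which the continuity of
    the operations of a Priestley algebra is stated. *)
Notation power n X := (prod_topology (fun _ : 'I_n => X)).

Section ProductTopology.
Context (I : eqType) (K : I -> topologicalType).

Lemma cvg_prod_topology (F : set_system (prod_topology K))
    (x : prod_topology K) :
  Filter F -> (forall i, proj i @ F --> x i) -> F --> x.
Proof.
move=> FF Fx; apply/cvg_sup => i U [V] [[W] oW <-] Wx WU.
apply: (filterS WU); apply: (Fx i W).
exact: open_nbhs_nbhs.
Qed.

Lemma continuous_prod_topology (T : topologicalType)
    (g : T -> prod_topology K) :
  (forall i, continuous (fun t => g t i)) -> continuous g.
Proof. by move=> cg t; apply: cvg_prod_topology => i; exact: cg. Qed.

Lemma compact_prod_topology :
  (forall i, compact [set: K i]) -> compact [set: prod_topology K].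
Proof.
move=> cK; have := tychonoff cK; congr (@compact _ _).
by apply/seteqP.
Qed.

End ProductTopology.

Lemma compact_hausdorff_closed_image (S T : topologicalType) (g : S -> T)
    (A : set S) :
  continuous g -> compact [set: S] -> hausdorff_space T -> closed A ->
  closed (g @` A).
Proof.
move=> cg cS hT cA; apply: compact_closed => //.
apply: continuous_compact; first exact: continuous_subspaceT.
exact: subclosed_compact cA cS _.
Qed.

Lemma clopen_near (T : topologicalType) (A : set T) (x : T) : clopen A ->
  \forall y \near x, A y <-> A x.
Proof.
move=> [oA cA]; have [Ax|nAx] := pselect (A x).
  by apply: filterS (open_nbhs_nbhs (conj oA Ax)) => y /= Ay.
have oC : open (~` A) by rewrite openC.
by apply: filterS (open_nbhs_nbhs (conj oC nAx)) => y /= Ay.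
Qed.

Lemma clopen_forall (T : topologicalType) (I : finType) (P : I -> set T) :
  (forall i, clopen (P i)) -> clopen [set x | forall i, P i x].
Proof.
move=> cP; split.
  rewrite openE => x Px; apply: (filter_forall (nbhs_filter x)) => i.
  by have [oP _] := cP i; exact: open_nbhs_nbhs (conj oP (Px i)).
rewrite (_ : mkset _ = \bigcap_i P i); last first.
  by apply/seteqP; split=> [x Px i _|x Px i]; exact: Px.
by apply: closed_bigI => i _; have [] := cP i.
Qed.

Lemma priestley_hausdorff d (X : priestleyType d) : hausdorff_space X.
Proof.
have sep (x y : X) : ~ (x <= y) -> exists2 U : set X, clopen U & U y /\ ~ U x.
  by move=> /priestley_separated[U [cU _ Uy nUx]]; exists U.
rewrite open_hausdorff => x y.
have split_by (U : set X) : clopen U -> open U /\ open (~` U).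
  by move=> [oU cU]; split=> //; rewrite openC.
have [xy|/sep[U /split_by[oU oCU] [Uy nUx]] _] := pselect (x <= y); last first.
  by exists (~` U, U); rewrite /= ?inE //; split=> //; rewrite setICl.
have [yx|/sep[U /split_by[oU oCU] [Ux nUy]] _] := pselect (y <= x).
  by rewrite eq_le xy yx.
by exists (U, ~` U); rewrite /= ?inE //; split=> //; rewrite setICr.
Qed.

(** * The Priestley space of prime filters *)

Section PrimeFilterSpace.
Context d (D : tbDistrLatticeType d).
Local Notation X := (prime_filter D).
Implicit Types (x y : X) (a : D).

Lemma pf_ext x y : pf_set x = pf_set y -> x = y.
Proof.
move=> xy; apply/eqP; rewrite eq_le.
by apply/andP; split; apply/asboolP => a; rewrite xy.
Qed.

Lemma pf_filter x : is_filter (pf_set x).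
Proof. by have [] := pf_prime x. Qed.

Lemma pf_cvg (F : set_system X) x : Filter F ->
  (forall a, \forall y \near F, pf_set y a <-> pf_set x a) -> F --> x.
Proof.
move=> FF Fx A; rewrite nbhsE => -[B [oB Bx] BA].
move: oB Bx BA => [C sC <-] [E CE Ex] BA; rewrite nbhs_filterE.
apply: (@filterS _ F _ E) => [y Ey|]; first by apply: BA; exists E.
have [S sS ES] := sC _ CE; rewrite -ES; apply: filter_bigI => U SU.
have Ux : U x by move: Ex; rewrite -ES; exact.
have := sS _ SU; rewrite inE => -[a []]; rewrite ?complEset => Ua;
  rewrite Ua in Ux *.
  by apply: filterS (Fx a) => y /= [_]; exact.
by apply: filterS (Fx a) => y /= [yx _] /yx.
Qed.

Lemma pf_continuous (T : topologicalType) (g : T -> X) :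
  (forall t a, \forall s \near t, pf_set (g s) a <-> pf_set (g t) a) ->
  continuous g.
Proof. by move=> gP t; apply: pf_cvg => a; exact: gP. Qed.

Lemma pf_clopen a : clopen [set x : X | pf_set x a].
Proof.
have sub (U : set X) : pf_subbase U -> open U.
  move=> sU; exists [set U]; last first.
    by apply/seteqP; split=> [y [_ ->]|y Uy] //; exists U.
  move=> _ ->; exists [fset U]%fset.
    by move=> V /fset1P ->; apply: mem_set.
  apply/seteqP; split=> y /= => [VU|Uy V /fset1P -> //].
  by apply: VU; exact: fset11.
split; first by apply: sub; exists a; left.
by rewrite -openC; apply: sub; exists a; right.
Qed.

(** An ultrafilter U on the space converges to the prime filter of those a for
    which U contains the basic set of a. *)
Lemma pf_compact : compact [set: X].
Proof.
rewrite compact_ultra => F FU _.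
pose P : set D := [set a | F [set x | pf_set x a]].
have pP : is_prime_filter P.
  split; [split| |].
  - by apply: filterE => x; have [[]] := pf_prime x.
  - move=> a b Fa Fb; apply: filterS (filterI Fa Fb) => x [xa xb].
    by have [[_ + _] _ _] := pf_prime x; exact.
  - move=> a b ab Fa; apply: filterS Fa => x xa.
    by have [[_ _ +] _ _] := pf_prime x; apply; first exact: ab.
  - move=> /filter_ex [x].
    by have [] := pf_prime x.
  - move=> a b Fab.
    have [Fa|Fa] := in_ultra_setVsetC [set x : X | pf_set x a] FU.
      by left.
    right; apply: filterS (filterI Fab Fa) => x [xab xa].
    by have [_ _ /(_ _ _ xab)[]] := pf_prime x.
exists (PrimeFilter pP); split=> //; apply: pf_cvg => a /=.
have [Fa|Fa] := in_ultra_setVsetC [set x : X | pf_set x a] FU.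
  by apply: filterS (Fa) => x /= xa.
apply: filterS (Fa) => x /= nxa; split=> // Fa'.
have F0 : F set0.
  by rewrite -(setICl [set x : X | pf_set x a]); exact: filterI.
by case: (filter_not_empty F F0).
Qed.

Lemma pf_separated x y : ~ (x <= y) ->
  exists U : set X,
    [/\ clopen U, forall u v, u <= v -> U v -> U u, U y & ~ U x].
Proof.
move=> xy; have /existsNP[a /not_implyP[ya xa]] : ~ (pf_set y `<=` pf_set x).
  by move=> yx; apply: xy; apply/asboolP.
exists [set z | pf_set z a]; split=> //; first exact: pf_clopen.
by move=> u v /asboolP; exact.
Qed.

HB.instance Definition _ :=
  isPriestley.Build (dual_display d) (prime_filter D) pf_compact pf_separated.

End PrimeFilterSpace.

(** * From algebras to spaces *)

Section DualAlgebra.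
Context tau d (D : residuationAlgType tau d).

(** The set is a union of boxes, one for each witness in the sense of
    [filter_opP]. *)
Lemma filter_op_open (f : opsym tau) (c : D) :
  open [set x : power (arity f) (prime_filter D) |
        filter_op (fun j => pf_set (x j)) c].
Proof.
rewrite openE => x /= /filter_opP -/(_ (fun j => pf_filter (x j))) [a xa ac].
have : nbhs x [set y | forall j, pf_set (y j) (a j)].
  apply: (@filter_forall _ _ (fun j => [set y | pf_set (y j) (a j)]) _
    (nbhs_filter x)) => j.
  have := @proj_continuous _ (fun=> prime_filter D) j x _
    (clopen_near (x j) (pf_clopen (a j))).
  by apply: (@filterS _ _ (nbhs_filter x)) => y [_]; apply; exact: xa.
apply: (@filterS _ _ (nbhs_filter x)) => y ya /=.
by apply/filter_opP => [j|]; [exact: pf_filter|exists a].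
Qed.

Lemma dual_relE (f : opsym tau) (x : 'I_(arity f) -> prime_filter D) z :
  dual_rel x z <-> filter_op (fun j => pf_set (x j)) `<=` pf_set z.
Proof.
split=> [R c [a [xa xc]]|R a c xa nzc xc].
  by apply: contrapT => nzc; exact: R xa nzc xc.
by apply: nzc; apply: R; exists a.
Qed.

End DualAlgebra.

(** A prime filter of a Boolean algebra contains either c or its complement, so
    the set is the complement of the open set given by the complement of c. *)
Lemma filter_op_closed_bool tau d (B : boolResiduationAlgType tau d)
    (f : opsym tau) (c : B) : join_preserving_at_primes B ->
  closed [set x : power (arity f) (prime_filter B) |
          filter_op (fun j => pf_set (x j)) c].
Proof.
move=> jpB; rewrite -openC.
rewrite (_ : ~` _ = [set x : power (arity f) (prime_filter B) |
   filter_op (fun j => pf_set (x j)) (~` c)%O]); first exact: filter_op_open.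
apply/seteqP; split=> x /=;
  have [[t I up] nb U] := jpB f _ (fun j => pf_prime (x j)).
  by move=> nc; have := t; rewrite -(joinxC c) => /U[].
by move=> nc yc; apply: nb; rewrite -(meetxC c); exact: I.
Qed.

Section Ideal.
Context tau d (D : residuationAlgType tau d).
Context d' (B : boolResiduationAlgType tau d').
Hypotheses (emb : embeds_as_residuation_ideal D B)
  (jpB : join_preserving_at_primes B).

(** The set is the image of a closed subset of the power of the dual space of B
    under the restriction of prime filters to D, a closed map. *)
Lemma filter_op_closed (f : opsym tau) (c : D) :
  closed [set x : power (arity f) (prime_filter D) |
          filter_op (fun j => pf_set (x j)) c].
Proof.
have [h [h_inj [h_bot h_top] [h_meet h_join] h_res h_ideal]] := emb.
pose hs (y : prime_filter B) : prime_filter D :=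
  PrimeFilter (prime_filter_preimage h_bot h_top h_meet h_join (pf_prime y)).
have chs : continuous hs.
  by apply: pf_continuous => y a; exact: clopen_near (pf_clopen (h a)).
pose hsn (y : power (arity f) (prime_filter B)) :
  power (arity f) (prime_filter D) := fun j => hs (y j).
have opE y : filter_op (fun j => pf_set (hsn y j)) =
    h @^-1` filter_op (fun j => pf_set (y j)).
  by rewrite filter_op_preimage // => j; exact: pf_filter.
have /= := compact_hausdorff_closed_image (g := hsn) _ _ _
  (@filter_op_closed_bool _ _ B f (h c) jpB).
rewrite (_ : hsn @` _ = [set x : power (arity f) (prime_filter D) |
        filter_op (fun j => pf_set (x j)) c]).
  apply.
  - apply: continuous_prod_topology => j y.
    apply: (continuous_comp
      (f := fun z : power (arity f) (prime_filter B) => z j)).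
      exact: (@proj_continuous _ (fun=> prime_filter B)).
    exact: chs.
  - by apply: compact_prod_topology => _; exact: pf_compact.
  - by apply: hausdorff_product => _; exact: priestley_hausdorff.
apply/seteqP; split=> [_ [y yc <-]|x xc] /=; first by rewrite opE.
have /choice [y xy] : forall j, exists y, hs y = x j.
  move=> j.
  have [G pG Gx] := prime_filter_lift h_meet h_join h_inj (pf_prime (x j)).
  by exists (PrimeFilter pG); exact: pf_ext.
exists y; last by apply/funext.
move: xc.
rewrite /= (_ : (fun j => pf_set (x j)) = fun j => pf_set (hsn y j)) ?opE //.
by apply/funext => j; rewrite /hsn xy.
Qed.

Lemma dual_of_residuation_ideal :
  exists (d : Order.disp_t) (X : priestleyAlgType tau d),
    ext_iso (priestleyAlg_space X) (dual_space D).
Proof.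
have jpD := residuation_ideal_join_preserving emb jpB.
pose op f x : prime_filter D :=
  PrimeFilter (jpD f _ (fun j => pf_prime (x j))).
have cop f : continuous
    (op f : power (arity f) (prime_filter D) -> prime_filter D).
  apply: pf_continuous => x c.
  have clopen_op := conj (@filter_op_open tau d D f c) (@filter_op_closed f c).
  exact: clopen_near clopen_op.
have mop f (x y : 'I_(arity f) -> prime_filter D) :
    (forall j, x j <= y j) -> op f x <= op f y.
  move=> xy; apply/asboolP => c /= [a [ya yc]].
  have {}xy j : pf_set (y j) `<=` pf_set (x j) by apply/asboolP; exact: xy.
  by exists a; split=> [k|]; exact: xy.
pose X : priestleyAlgType tau (dual_display d) := HB.pack (prime_filter D)
  (isPriestleyAlg.Build tau (dual_display d) (prime_filter D) cop mop).
exists (dual_display d), X, id, id; split=> //.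
  by split=> x; exact: cvg_id.
move=> f x z; rewrite /= -[X in _ <-> X]/(dual_rel x z) dual_relE.
by split=> [/asboolP|?]; last apply/asboolP.
Qed.

End Ideal.

(** * Residuation on clopen sets *)

Section Residual.
Context tau d (X : priestleyAlgType tau d).

Definition residual (f : opsym tau) (i : 'I_(arity f))
    (a : 'I_(arity f).-1 -> set X) (c : set X) : set X :=
  [set t | forall x : 'I_(arity f) -> X,
     x i = t -> (forall k, a k (x (lift i k))) -> c (op f x)].

Lemma op_preimage_clopen (f : opsym tau) (c : set X) : clopen c ->
  clopen [set x : power (arity f) X | c (op f x)].
Proof.
move=> [oc cc]; split.
  by apply: open_comp oc => x _; exact: op_continuous.
by apply: preimage_closed cc => x _; exact: op_continuous.
Qed.

Lemma proj_preimage_clopen n (i : 'I_n) (c : set X) : clopen c ->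
  clopen [set x : power n X | c (x i)].
Proof.
have ci := @proj_continuous _ (fun _ : 'I_n => X) i.
by move=> [oc cc]; split; [apply: open_comp oc|apply: preimage_closed cc].
Qed.

(** The complement of the residual is a projection of a clopen set of tuples,
    and projections from a power of X are open, and closed by compactness. *)
Lemma residual_clopen (f : opsym tau) (i : 'I_(arity f))
    (a : 'I_(arity f).-1 -> set X) (c : set X) :
  (forall k, clopen (a k)) -> clopen c -> clopen (residual i a c).
Proof.
move=> ca cc.
pose S : set (power (arity f) X) :=
  [set x | forall k, a k (x (lift i k))] `&` ~` [set x | c (op f x)].
have [oS cS] : clopen S.
  apply: clopenI; last first.
    exact: (@clopenC (power (arity f) X) _ setT (op_preimage_clopen f cc)).
  apply: (@clopen_forall (power (arity f) X)) => k.
  exact: proj_preimage_clopen (ca k).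
suff -> : residual i a c = ~` (proj i @` S).
  split.
    rewrite openC; apply: compact_hausdorff_closed_image cS.
    - exact: (@proj_continuous _ (fun=> X)).
    - by apply: compact_prod_topology => _; exact: priestley_compact.
    - exact: priestley_hausdorff.
  by rewrite closedC; exact: proj_open.
apply/seteqP; split=> [t tc [x [xa xc] xt]|t nS x xt xa].
  by apply: xc; exact: tc.
by apply: contrapT => xc; apply: nS; exists x.
Qed.

Definition is_downset (U : set X) := forall u v : X, u <= v -> U v -> U u.

Lemma residual_downset (f : opsym tau) (i : 'I_(arity f))
    (a : 'I_(arity f).-1 -> set X) (c : set X) :
  is_downset c -> is_downset (residual i a c).
Proof.
move=> dc u v uv vc x xu xa.
pose y j := if j == i then v else x j.
apply: (dc _ (op f y)).
  by apply: op_monotone => j; rewrite /y; case: eqP => [->|_]; rewrite ?xu.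
apply: vc; first by rewrite /y eqxx.
by move=> k; rewrite /y eq_sym (negbTE (neq_lift _ _)).
Qed.

(** Clopen sets and clopen down-sets are the two instances of interest. The sets
    a_k range over all clopen sets, not just over the members, so that the
    closure condition is the one of residuation ideals. *)
Record clopen_family := ClopenFamily {
  family_set :> set (set X);
  family_clopen : family_set `<=` clopen;
  family0 : family_set set0;
  familyT : family_set setT;
  familyI : forall U V, family_set U -> family_set V -> family_set (U `&` V);
  familyU : forall U V, family_set U -> family_set V -> family_set (U `|` V);
  family_residual : forall (f : opsym tau) (i : 'I_(arity f))
      (a : 'I_(arity f).-1 -> set X) (c : set X),
    (forall k, clopen (a k)) -> family_set c -> family_set (residual i a c)
}.

Record member (L : clopen_family) := Member {
  member_set :> set X;
  member_in : family_set L member_set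
}.

End Residual.

Section FamilyAlgebra.
Context tau d (X : priestleyAlgType tau d) (L : clopen_family X).
Local Notation E := (member L).
Implicit Types U V W : E.

HB.instance Definition _ := gen_eqMixin E.
HB.instance Definition _ := gen_choiceMixin E.

Lemma member_inj : injective (@member_set tau d X L).
Proof.
move=> [U LU] [V LV] /= UV; subst V.
by congr Member; exact: Prop_irrelevance.
Qed.

Lemma member_clopen U : clopen (U : set X).
Proof. exact: family_clopen (member_in U). Qed.

Definition member_le U V : bool := `[< (U : set X) `<=` V >].
Definition member_lt U V : bool := (V != U) && member_le U V.
Definition member0 : E := Member (family0 L).
Definition memberT : E := Member (familyT L).
Definition memberI U V : E := Member (familyI (member_in U) (member_in V)).
Definition memberU U V : E := Member (familyU (member_in U) (member_in V)).

Fact member_le_def U V : member_le U V = (memberI U V == U).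
Proof.
apply/asboolP/eqP => [UV|<-]; last by move=> x [].
by apply: member_inj => /=; apply/setIidPl.
Qed.

Fact member_lt_def U V : member_lt U V = (V != U) && member_le U V.
Proof. by []. Qed.

Fact memberIC : commutative memberI.
Proof. by move=> U V; apply: member_inj; exact: setIC. Qed.

Fact memberUC : commutative memberU.
Proof. by move=> U V; apply: member_inj; exact: setUC. Qed.

Fact memberIA : associative memberI.
Proof. by move=> U V W; apply: member_inj; exact: setIA. Qed.

Fact memberUA : associative memberU.
Proof. by move=> U V W; apply: member_inj; exact: setUA. Qed.

Fact memberUKI V U : memberI U (memberU U V) = U.
Proof. by apply: member_inj; rewrite /= setUC setKU. Qed.

Fact memberIKU V U : memberU U (memberI U V) = U.
Proof. by apply: member_inj; rewrite /= setIC setKI. Qed.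

Fact memberIUl : left_distributive memberI memberU.
Proof. by move=> U V W; apply: member_inj; exact: setIUl. Qed.

Fact memberII : idempotent_op memberI.
Proof. by move=> U; apply: member_inj; exact: setIid. Qed.

HB.instance Definition _ := Order.isMeetJoinDistrLattice.Build set_display E
  member_le_def member_lt_def memberIC memberUC memberIA memberUA memberUKI
  memberIKU memberIUl memberII.

Fact member0_le U : member0 <= U.
Proof. by apply/asboolP => x. Qed.

Fact member_leT U : U <= memberT.
Proof. by apply/asboolP => x. Qed.

HB.instance Definition _ := Order.hasBottom.Build set_display E member0_le.
HB.instance Definition _ := Order.hasTop.Build set_display E member_leT.

Definition member_res (f : opsym tau) (i : 'I_(arity f))
    (a : 'I_(arity f).-1 -> E) (c : E) : E :=
  Member (family_residual i (fun k => member_clopen (a k)) (member_in c)).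

Fact member_res_top (f : opsym tau) (i : 'I_(arity f))
    (a : 'I_(arity f).-1 -> E) :
  member_res i a \top = \top.
Proof. by apply: member_inj; apply/seteqP. Qed.

Fact member_res_meet (f : opsym tau) (i : 'I_(arity f))
    (a : 'I_(arity f).-1 -> E) (b c : E) :
  member_res i a (b `&` c)%O = (member_res i a b `&` member_res i a c)%O.
Proof.
apply: member_inj; apply/seteqP; split=> [t tbc|t [tb tc] x xt xa].
  by split=> x xt xa; have [] := tbc x xt xa.
by split; [exact: tb xt xa|exact: tc xt xa].
Qed.

(** The right-hand side does not mention i: this is the exchange law. *)
Lemma member_resP (f : opsym tau) (i : 'I_(arity f))
    (a : 'I_(arity f) -> E) (c : E) :
  a i <= member_res i (fun k => a (lift i k)) c <->
  forall x, (forall j, (a j : set X) (x j)) -> (c : set X) (op f x).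
Proof.
split=> [/asboolP ac x xa|ac]; first exact: ac (xa i) _ _ _.
apply/asboolP => t ta x xt xa; apply: ac => j.
by have [k|] := unliftP i j => ->; [exact: xa|rewrite xt].
Qed.

Fact member_res_exchange (f : opsym tau) (i j : 'I_(arity f))
    (a : 'I_(arity f) -> E) (c : E) :
  a i <= member_res i (fun k => a (lift i k)) c <->
  a j <= member_res j (fun k => a (lift j k)) c.
Proof. by rewrite !member_resP. Qed.

HB.instance Definition _ := isResiduation.Build tau set_display E
  member_res_top member_res_meet member_res_exchange.

Definition point_filter (x : X) : set E := [set U | (U : set X) x].

Lemma point_filter_prime x : is_prime_filter (point_filter x).
Proof.
split; [split| |] => //.
by move=> U V /asboolP; exact.
Qed.

(** Primality makes the differences of a member in F and a member outside F
    a base of nonempty closed sets, so they have a common point. *)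
Lemma prime_filter_point (F : set E) : is_prime_filter F ->
  exists x, F = point_filter x.
Proof.
move=> [[Ft FI Fup] Fb FU].
pose D := [set UV : E * E | F UV.1 /\ ~ F UV.2].
pose S (UV : E * E) : set X := UV.1 `\` UV.2.
have FF : Filter (filter_from D S).
  apply: filter_from_filter; first by exists (\top, \bot).
  move=> [U V] [U' V'] [/= FUu nFV] [/= FU' nFV'].
  exists (U `&` U', V `|` V')%O.
    by split; [exact: FI|move=> /FU[]].
  by move=> x [/= [Ux U'x] /not_orP[nVx nV'x]].
have PF : ProperFilter (filter_from D S).
  apply: filter_from_proper => -[U V] [/= FUu nFV].
  apply: contrapT => nS; apply: nFV; apply: Fup FUu; apply/asboolP => x Ux.
  by apply: contrapT => nVx; apply: nS; exists x.
have [x [_]] := @priestley_compact _ X _ PF filterT.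
rewrite clusterE => Fx.
have inS U V : F U -> ~ F V -> (U : set X) x /\ ~ (V : set X) x.
  move=> FUu nFV.
  have cS : closed (S (U, V)).
    apply: closedI; first by have [] := member_clopen U.
    by apply: open_closedC; have [] := member_clopen V.
  by apply: cS; apply: Fx; exists (U, V).
exists x; apply/seteqP; split=> U.
  by move=> FUu; have [] := inS _ _ FUu Fb.
by move=> Ux; apply: contrapT => nFU; have [_] := inS _ _ Ft nFU; exact.
Qed.

(** If every box of members around x contained a tuple that f sends outside c,
    then, boxes being stable under intersection, compactness of the power would
    give such a tuple y lying in all of these boxes. *)
Lemma op_box (f : opsym tau) (x : 'I_(arity f) -> X) (c : set X) :
  clopen c ->
  (forall y, (forall j U, point_filter (x j) U -> point_filter (y j) U) ->
     c (op f y)) ->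
  exists2 a : 'I_(arity f) -> E, (forall j, point_filter (x j) (a j)) &
    forall y, (forall j, point_filter (y j) (a j)) -> c (op f y).
Proof.
move=> cc xc; apply: contrapT => nbox.
pose D := [set a : 'I_(arity f) -> E | forall j, point_filter (x j) (a j)].
pose S (a : 'I_(arity f) -> E) : set (power (arity f) X) :=
  [set y | (forall j, point_filter (y j) (a j)) /\ ~ c (op f y)].
have FF : Filter (filter_from D S).
  apply: filter_from_filter; first by exists (fun=> \top).
  move=> a b Da Db; exists (fun j => a j `&` b j)%O.
    by move=> j; split; [exact: Da|exact: Db].
  by move=> y [yab nc]; split; split=> // j; have [] := yab j.
have PF : ProperFilter (filter_from D S).
  apply: filter_from_proper => a Da; apply: contrapT => nS; apply: nbox.
  by exists a => // y ya; apply: contrapT => nc; apply: nS; exists y.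
have cX : compact [set: power (arity f) X].
  by apply: compact_prod_topology => _; exact: priestley_compact.
have [y [_]] := cX _ PF filterT.
rewrite clusterE => Fy.
have [_ ncc] : clopen (~` [set y : power (arity f) X | c (op f y)]).
  exact: (@clopenC (power (arity f) X) _ setT (op_preimage_clopen f cc)).
have : (~` [set y : power (arity f) X | c (op f y)]) y.
  by apply: ncc; apply: Fy; exists (fun=> \top) => // z [].
apply; apply: xc => j U Ux.
have [_ cU] := proj_preimage_clopen j (member_clopen U).
(* The box constrained to U at j only shows that y_j is in U. *)
apply: (cU y); apply: Fy; exists (fun k => if k == j then U else \top).
  by move=> k /=; case: eqP => [->|].
by move=> z [/(_ j)]; rewrite eqxx.
Qed.

End FamilyAlgebra.

Arguments point_filter {tau d X} L x.
Arguments point_filter_prime {tau d X} L x.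
Arguments Member {tau d X} L member_set member_in.

Section ClopenAlgebra.
Context tau d (X : priestleyAlgType tau d).

Definition clopens : clopen_family X.
Proof.
refine (@ClopenFamily _ _ X clopen _ _ _ _ _ _).
- by [].
- by split; [exact: open0|exact: closed0].
- by split; [exact: openT|exact: closedT].
- by move=> U V; exact: clopenI.
- by move=> U V [? ?] [? ?]; split; [exact: openU|exact: closedU].
- by move=> f i a c ca; exact: residual_clopen.
Defined.

Definition clopen_downsets : clopen_family X.
Proof.
refine (@ClopenFamily _ _ X [set U | clopen U /\ is_downset U] _ _ _ _ _ _).
- by move=> U [].
- by split=> //; split; [exact: open0|exact: closed0].
- by split=> //; split; [exact: openT|exact: closedT].
- move=> U V [cU dU] [cV dV]; split; first exact: clopenI.
  by move=> u v uv [Uv Vv]; split; [exact: dU Uv|exact: dV Vv].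
- move=> U V [[? ?] dU] [[? ?] dV].
  split; first by split; [exact: openU|exact: closedU].
  by move=> u v uv [Uv|Vv]; [left; exact: dU Uv|right; exact: dV Vv].
- move=> f i a c ca [cc dc].
  by split; [exact: residual_clopen|exact: residual_downset].
Defined.

Definition memberC (U : member clopens) : member clopens :=
  Member clopens (~` (U : set X)) (clopenC setT (member_in U)).

Fact memberUCx (U : member clopens) : (U `|` memberC U)%O = \top.
Proof. by apply: member_inj; exact: setUv. Qed.

Fact memberICx (U : member clopens) : (U `&` memberC U)%O = \bot.
Proof. by apply: member_inj; exact: setICr. Qed.

HB.instance Definition _ :=
  Order.TBDistrLattice_hasComplement.Build set_display
    (member clopens) memberUCx memberICx.

Definition clopen_algebra : boolResiduationAlgType tau set_display :=
  member clopens.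

Definition downset_algebra : residuationAlgType tau set_display :=
  member clopen_downsets.

(** * From spaces to algebras *)

(** Clopen sets separate points, so x is the only tuple lying in all clopen
    boxes around x, and [op_box] applies to any clopen c containing f(x). *)
Lemma clopen_filter_op (f : opsym tau) (x : 'I_(arity f) -> X) :
  filter_op (fun j => point_filter clopens (x j)) =
  point_filter clopens (op f x).
Proof.
have fx j : is_filter (point_filter clopens (x j)).
  by have [] := point_filter_prime clopens (x j).
apply/seteqP; split=> c; rewrite filter_opP //.
  by move=> [a xa /member_resP]; apply.
move=> xc.
have [y xy|a xa ac] := @op_box _ _ _ clopens f x c (member_clopen c).
  suff -> : y = x by [].
  apply/funext => j; apply/eqP; rewrite eq_sym eq_le; apply/andP; split.
    apply: contrapT => /priestley_separated[U [cU _ Uy nUx]].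
    by have := xy j (memberC (Member clopens U cU)) nUx; exact.
  apply: contrapT => /priestley_separated[U [cU _ Ux nUy]].
  by apply: nUy; exact: (xy j (Member clopens U cU)).
exists a => //; exact/member_resP.
Qed.

Lemma clopen_algebra_join_preserving : join_preserving_at_primes clopen_algebra.
Proof.
move=> f F pF.
have /choice [x Fx] : forall j, exists x, F j = point_filter clopens x.
  by move=> j; exact: prime_filter_point (pF j).
have -> : F = fun j => point_filter clopens (x j) by exact/funext.
rewrite clopen_filter_op; exact: point_filter_prime.
Qed.

Lemma downset_algebra_embeds :
  embeds_as_residuation_ideal downset_algebra clopen_algebra.
Proof.
pose h (U : downset_algebra) : clopen_algebra :=
  Member clopens (U : set X) (member_clopen U).
have rangeP (U : clopen_algebra) : is_downset (U : set X) -> range h U.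
  move=> dU.
  exists (Member clopen_downsets (U : set X) (conj (member_in U) dU)) => //.
  exact: member_inj.
have rangeD U : range h U -> is_downset (U : set X).
  by move=> [V _ <-]; have [] := member_in V.
exists h; split.
- move=> U V UV; apply: member_inj.
  exact: (congr1 (@member_set _ _ X clopens) UV).
- by split; exact: member_inj.
- by split=> U V; exact: member_inj.
- by move=> f i a c; exact: member_inj.
- split.
  + exact: rangeP.
  + exact: rangeP.
  + move=> U V /rangeD dU /rangeD dV; apply: rangeP => u v uv [Uv Vv].
    by split; [exact: dU Uv|exact: dV Vv].
  + move=> U V /rangeD dU /rangeD dV; apply: rangeP => u v uv [Uv|Vv].
      by left; exact: dU Uv.
    by right; exact: dV Vv.
  + by move=> f i b c /rangeD dc; apply: rangeP; exact: residual_downset.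
Qed.

(** The relations agree by [op_box]: a tuple lying in all boxes of clopen
    down-sets around x is below x, hence is sent by f into each clopen down-set
    containing f(x). *)
Lemma priestleyAlg_dual :
  ext_iso (priestleyAlg_space X) (dual_space downset_algebra).
Proof.
pose L := clopen_downsets.
pose phi (x : X) : prime_filter downset_algebra :=
  PrimeFilter (point_filter_prime L x).
have /choice [psi psiP] :
    forall y : prime_filter downset_algebra, exists x, phi x = y.
  move=> y; have [x xy] := prime_filter_point (pf_prime y).
  by exists x; exact/pf_ext.
have phi_le x y : (phi x <= phi y) = (x <= y).
  apply/asboolP/idP => /= [sub|xy U /=]; last first.
    by have [_ dU] := member_in U; exact: dU.
  apply: contrapT => /priestley_separated[U [cU dU Uy nUx]].
  by apply: nUx; exact: (sub (Member L U (conj cU dU))).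
have phi_inj : injective phi.
  by move=> x y xy; apply/eqP; rewrite eq_le -!phi_le xy lexx.
have phiK : cancel phi psi by move=> x; apply: phi_inj; exact: psiP.
have cphi : continuous phi.
  by apply: pf_continuous => x U; exact: clopen_near (member_clopen U).
exists phi, psi; split=> //.
- split=> //; apply/continuousP => A oA.
  rewrite -[_ @^-1` _]setCK openC.
  rewrite (_ : ~` _ = phi @` ~` A).
    apply: compact_hausdorff_closed_image => //.
    + exact: priestley_compact.
    + exact: priestley_hausdorff.
    + exact: open_closedC.
  apply/seteqP; split=> [y nAy|_ [x nAx <-]] /=; last by rewrite phiK.
  by exists (psi y).
- move=> f x z.
  rewrite -[X in _ <-> X]/(dual_rel (phi \o x) (phi z)) dual_relE.
  split=> [zx c /filter_opP|sub /=].
    move=> [j|a xa /member_resP ac]; first exact: pf_filter.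
    have [_ dc] := member_in c; apply: dc zx _; exact: ac.
  apply: contrapT => /priestley_separated[c [cc dc xc nzc]].
  have [y xy|a xa ac] := @op_box _ _ X L f x c cc.
    apply: dc xc; apply: op_monotone => j.
    by rewrite -phi_le; apply/asboolP; exact: xy.
  apply: nzc; apply: (sub (Member L c (conj cc dc))).
  apply/filter_opP => [j|]; first exact: pf_filter.
  by exists a => //; apply/member_resP.
Qed.

End ClopenAlgebra.

Theorem corollary3p30 (tau : optype) :
  (forall (d : Order.disp_t) (X : priestleyAlgType tau d),
     exists (dD : Order.disp_t) (D : residuationAlgType tau dD),
       (exists (dB : Order.disp_t) (B : boolResiduationAlgType tau dB),
          join_preserving_at_primes B /\ embeds_as_residuation_ideal D B) /\
       ext_iso (priestleyAlg_space X) (dual_space D)) /\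
  (forall (dD : Order.disp_t) (D : residuationAlgType tau dD),
     (exists (dB : Order.disp_t) (B : boolResiduationAlgType tau dB),
        join_preserving_at_primes B /\ embeds_as_residuation_ideal D B) ->
     exists (d : Order.disp_t) (X : priestleyAlgType tau d),
       ext_iso (priestleyAlg_space X) (dual_space D)).
Proof.
split=> [d X|dD D [dB [B [jpB emb]]]]; last first.
  exact: dual_of_residuation_ideal emb jpB.
exists set_display, (downset_algebra X); split; last exact: priestleyAlg_dual.
exists set_display, (clopen_algebra X); split.
  exact: clopen_algebra_join_preserving.
exact: downset_algebra_embeds.
Qed.
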